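(* Let $n\ge 1$ and let $W=\{D_0,D_1,\ldots,D_s\}$ be an LCL collection of $n$-cells. Let $V=\{D_1,\ldots,D_p\}$ be the collection of all members of $W$ other than $D_0$ that intersect $D_0$ (numbered so that these are $D_1,\ldots,D_p$), and let $U=\{C_1,\ldots,C_p\}$, where $C_i=D_0\cap D_i$ for $i=1,\ldots,p$. Then $U$ is an LCL collection of $(n-1)$-cells, and the collections $V$ and $U$ are isomorphic.
   Context: All sets are subsets of a Euclidean space $E^q$ (with $q\ge n$), and cells are considered with their own intrinsic topology. For $m\ge 1$, an $m$-cell is a set $D$ homeomorphic to a closed $m$-dimensional ball in $\mathbb{R}^m$; $\operatorname{Int} D$ and $\partial D$ denote its (intrinsic) interior and boundary, so $D=\operatorname{Int}D\cup\partial D$ and $\partial D$ is homeomorphic to the $(m-1)$-sphere. A $0$-cell is a single point, with $\partial D=\varnothing$. Collections are finite indexed families. A collection $\{D_i\mid i\in I\}$ of $m$-cells is locally centered (LC) if for every $J\subseteq I$ such that $D_i\cap D_k\ne\varnothing$ for all $i,k\in J$, one has $\bigcap_{i\in J}D_i\neq\varnothing$. A collection of $m$-cells is locally lump (LL) if for every $k\ge 2$ and every non-empty intersection $E=D_{i_1}\cap\cdots\cap D_{i_k}$ of $k$ distinct members, $E=\partial D_{i_1}\cap\cdots\cap\partial D_{i_k}$ and $E$ is an $(m+1-k)$-cell (in particular a non-empty intersection of distinct members involves at most $m+1$ of them). A collection of $m$-cells is an LCL collection if it is both locally centered and locally lump. Two collections $\{D_1,D_2,\ldots\}$ and $\{C_1,C_2,\ldots\}$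 are isomorphic (via $D_i\leftrightarrow C_i$) if $D_i\cap D_k\cap\cdots\cap D_r\ne\varnothing$ if and only if $C_i\cap C_k\cap\cdots\cap C_r\neq\varnothing$, for every choice of indices. *)

(* Defs.v *)
From mathcomp Require Import all_boot all_order all_algebra.
From mathcomp Require Import all_classical all_reals all_analysis.

Set Implicit Arguments.
Unset Strict Implicit.
Unset Printing Implicit Defensive.

Import Order.TTheory GRing.Theory Num.Theory.
Import numFieldTopology.Exports numFieldNormedType.Exports.

Local Open Scope classical_set_scope.
Local Open Scope ring_scope.

(* Euclidean space E^q is 'rV[R]_q. The library norm on it is the sup norm,
   which gives the same topology; the Euclidean ball and sphere are therefore
   written with the sum of squares. *)
Definition eball (R : realType) (m : nat) : set 'rV[R]_m :=
  [set x | \sum_(i < m) x ord0 i ^+ 2 <= 1].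

Definition esphere (R : realType) (m : nat) : set 'rV[R]_m :=
  [set x | \sum_(i < m) x ord0 i ^+ 2 = 1].

(* Sets carry their subspace topologies; values of f and g outside A and B
   are irrelevant. *)
Definition homeomorphism (T U : topologicalType) (A : set T) (B : set U)
    (f : T -> U) : Prop :=
  [/\ set_bij A B f,
      {within A, continuous f} &
      exists g : U -> T, {within B, continuous g} /\ {in A, cancel f g}].

(* For m = 0 the ball is the whole one-point space 'rV[R]_0, so that a 0-cell
   is a single point (lemma is_cell0). *)
Definition is_cell (R : realType) (q m : nat) (D : set 'rV[R]_q) : Prop :=
  exists f, homeomorphism (@eball R m) D f.

(* Intrinsic boundary of an m-cell: the image of the unit sphere under a
   homeomorphism from the unit ball. By invariance of domain that image is the
   same for all homeomorphisms, so the union over them taken here is the image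
   under any one of them. *)
Definition cell_boundary (R : realType) (q m : nat) (D : set 'rV[R]_q) :
    set 'rV[R]_q :=
  [set y | exists f, homeomorphism (@eball R m) D f /\ (f @` @esphere R m) y].

Section collections.
Variables (R : realType) (q : nat) (I : finType).
Implicit Types (D : I -> set 'rV[R]_q) (J : {set I}).

(* The intersection over the empty J is the whole space. *)
Definition meet D J : set 'rV[R]_q := \bigcap_(i in [set` J]) D i.

Definition locally_centered D : Prop :=
  forall J,
    (forall i k, i \in J -> k \in J -> D i `&` D k !=set0) ->
    meet D J !=set0.

(* The conjunct #|J| <= m + 1 keeps the natural-number subtraction in the
   dimension m + 1 - #|J| from being truncated. *)
Definition locally_lump (m : nat) D : Prop :=
  forall J, (2 <= #|J|)%N -> meet D J !=set0 ->
    [/\ meet D J = meet (fun i => cell_boundary m (D i)) J,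
        (#|J| <= m.+1)%N &
        is_cell (m.+1 - #|J|) (meet D J)].

Definition LCL (m : nat) D : Prop :=
  [/\ forall i, is_cell m (D i), locally_centered D & locally_lump m D].

Definition isomorphic_collections D (C : I -> set 'rV[R]_q) : Prop :=
  forall J, (0 < #|J|)%N -> (meet D J !=set0 <-> meet C J !=set0).

End collections.

Lemma is_cell0 (R : realType) (q : nat) (D : set 'rV[R]_q) :
  is_cell 0 D <-> exists x, D = [set x].
Proof.
have ball0 (x : 'rV[R]_0) : eball x by rewrite /eball /= big_ord0 ler01.
split=> [[f [[fD _ Df] _ _]]|[x ->]].
  exists (f 0); apply/seteqP; split=> y /= => [/Df [z _ <-]|->].
    by rewrite (thinmx0 z).
  exact: fD.
exists (fun=> x); split.
- split=> [y _ //|y z _ _ _|y /= ->]; first by rewrite (thinmx0 y) (thinmx0 z).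
  by exists 0.
- by apply: continuous_subspaceT; exact: cst_continuous.
- exists (fun=> 0); split=> [|y _]; last by rewrite (thinmx0 y).
  by apply: continuous_subspaceT; exact: cst_continuous.
Qed.

Lemma cell_boundary0 (R : realType) (q : nat) (D : set 'rV[R]_q) :
  cell_boundary 0 D = set0.
Proof.
apply/seteqP; split=> // y [f [_ [x]]].
by rewrite /esphere /= big_ord0 => /eqP; rewrite eq_sym oner_eq0.
Qed.

(* Main.v *)
Require Import Defs.
From mathcomp Require Import all_boot all_order all_algebra all_fingroup.
From mathcomp Require Import all_classical all_reals all_analysis.
From mathcomp Require Import zify ring lra.

(** The members of U are the traces C_i of the cell D_0 on its neighbours D_i.
    That they are (n - 1)-cells, that U is locally centered, and that U and V
    are isomorphic is combinatorics: a meet of members of U indexed by J is the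
    meet of the members of W indexed by J and 0 together, so each of these
    properties is that of W at the larger index set ([link_LCL],
    [link_isomorphic]).

    The content is that C_i and C_k meet inside the intrinsic boundary of C_i.
    Both are (n - 1)-cells in the (n - 1)-sphere bounding D_0, and their
    intersection is an (n - 2)-cell ([cell_meet_boundary]). Let x be a common
    point that is interior to C_i. By invariance of domain C_i contains a
    neighbourhood of x in the sphere, hence all points of C_k close to x. Then a
    non-empty open part of C_k lies in C_i, so an (n - 1)-dimensional cube
    embeds in an (n - 2)-cell; composed with the inclusion of a hyperplane this
    embedding contradicts invariance of domain. To work in a vector space
    instead of a sphere, C_i is thickened to the cone of the points t * y with
    y in C_i and t close to 1.

    Invariance of domain ([invariance_of_domain]) is proved from a form of
    Brouwer's fixed point theorem, [zero_of_close_to_id]: on the unit cube, a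
    continuous map within distance 1 of the identity vanishes somewhere. Suppose
    that f embeds the cube and that f 0 is not interior to the image A. The
    inverse of f vanishes only at f 0. Push A radially out of a small ball that
    contains f 0 and whose centre is off A, and replace the inverse by a
    Lipschitz approximation of an extension of it. What is left is to avoid 0 on
    the sphere of the ball; as a Lipschitz image of a set of lower dimension
    cannot fill a cube, subtracting a small constant does it
    ([lipschitz_sphere_avoid]). The resulting map, composed with f, is close to
    the identity and has no zero.

    The existence of zeros comes from Sperner's lemma on a fine cubical grid
    ([sperner]), whose parity argument is organised as an identity of
    determinants over the field with two elements. *)

Set Implicit Arguments.
Unset Strict Implicit.
Unset Printing Implicit Defensive.

Import Order.TTheory GRing.Theory Num.Def Num.Theory.
Import numFieldTopology.Exports numFieldNormedType.Exports.

Local Open Scope classical_set_scope.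
Local Open Scope ring_scope.

(** * Sperner's lemma on a cubical grid *)

(** Modulo 2 a determinant is a permanent, so the determinant of this matrix is 1
    exactly when [c] maps {0, .., k} onto itself. *)
Definition label_mx (k : nat) (c : nat -> nat) : 'M['F_2]_k.+1 :=
  \matrix_(a, j) (c j == a :> nat)%:R.

Lemma F2_addrr (x : 'F_2) : x + x = 0.
Proof. by apply: (@addrr_pchar2 'F_2); exact: pchar_Fp. Qed.

Lemma F2_oppr (x : 'F_2) : - x = x.
Proof. by apply: (@oppr_pchar2 'F_2); exact: pchar_Fp. Qed.

(** The counting step of Sperner's lemma: a simplex with labels at most k + 1
    carries all of them iff an odd number of its facets carry 0..k. Every column
    has a single entry 1, so adding all rows to the last one fills it with 1;
    expanding along it yields the facets. *)
Lemma det_label_mx_facets (k : nat) (c : nat -> nat) :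
  (forall j, (j <= k.+1)%N -> (c j <= k.+1)%N) ->
  \det (label_mx k.+1 c) =
    \sum_(j < k.+2) \det (label_mx k (fun t => c (bump j t))).
Proof.
move=> cle.
pose E : 'M['F_2]_k.+2 := \matrix_(a, b) ((a == b) || (a == ord_max))%:R.
have detE : \det E = 1.
  rewrite det_trig.
    by rewrite big1 // => i _; rewrite mxE eqxx.
  apply/is_trig_mxP => i j ij; rewrite mxE.
  have /negbTE-> : i != j by rewrite -val_eqE /= neq_ltn ij.
  have /negbTE-> : i != ord_max.
    by rewrite -val_eqE /= neq_ltn (leq_trans ij) // -ltnS ltn_ord.
  by [].
rewrite -[LHS]mul1r -detE -det_mulmx (expand_det_row _ ord_max).
apply: eq_bigr => j _.
have -> : (E *m label_mx k.+1 c) ord_max j = 1.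
  have cj : (c j < k.+2)%N := cle j (ltn_ord j).
  rewrite mxE (bigD1 (Ordinal cj)) //= !mxE eqxx orbT.
  rewrite !eqxx mulr1 big1 ?addr0 // => b; rewrite -val_eqE /= => bc.
  by rewrite !mxE (eq_sym (c j)) (negbTE bc) mulr0.
rewrite mul1r /cofactor F2_oppr expr1n mul1r; congr (\det _).
apply/matrixP => a b; rewrite !mxE (bigD1 (lift ord_max a)) //= !mxE.
rewrite eqxx mul1r big1 ?addr0; first by rewrite lift_max.
move=> i ia; rewrite !mxE eq_sym (negbTE ia) orFb.
have /negbTE-> : lift ord_max a != ord_max by rewrite eq_sym neq_lift.
by rewrite mul0r.
Qed.

Lemma det_label_mx_neq0 (k : nat) (c : nat -> nat) (a : nat) :
  \det (label_mx k c) != 0 -> (a <= k)%N ->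
  exists2 j : nat, (j <= k)%N & c j = a.
Proof.
move=> det0 ak; case: (pickP (fun j : 'I_k.+1 => c j == a :> nat)) => [j /eqP|no].
  by exists j => //; rewrite -ltnS.
case/negP: det0; apply/eqP; rewrite (expand_det_row _ (Ordinal (ak : (a < k.+1)%N))).
by rewrite big1 // => j _; rewrite mxE /= no mul0r.
Qed.

(** Sperner's lemma for the Kuhn triangulation of a grid with N + 1 cells per
    side. A maximal simplex is a flag (z, s): it starts at the lower corner z of
    a cell and increases one coordinate at a time, coordinate i at step s i. For
    k <= m, the simplices of the face where the coordinates k, k + 1, .. vanish
    are the flags for which z vanishes and s is the identity at these
    coordinates; only their first k + 1 vertices belong to the face, and the
    later steps, in a fixed order, merely pad the flag. All faces thus share one
    index type. *)
Section Sperner.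
Variables (m N : nat) (lab : {ffun 'I_m -> nat} -> nat).
Hypothesis lab_le : forall z, (lab z <= m)%N.
Hypothesis lab_bot : forall (z : {ffun 'I_m -> nat}) (i : 'I_m),
  z i = 0%N -> (lab z <= i)%N.
Hypothesis lab_top : forall (z : {ffun 'I_m -> nat}) (i : 'I_m),
  z i = N.+1 -> lab z <> i.

Let flag := ({ffun 'I_m -> 'I_N.+1} * 'S_m)%type.

Definition vert (x : flag) (j : nat) : {ffun 'I_m -> nat} :=
  [ffun i => (x.1 i + (x.2 i < j))%N].

Definition in_face (k : nat) (x : flag) : bool :=
  [forall i : 'I_m, (k <= i)%N ==> (x.1 i == 0 :> nat) && (x.2 i == i)].

Lemma in_faceP k (x : flag) : reflect
  (forall i : 'I_m, (k <= i)%N -> x.1 i = 0%N :> nat /\ x.2 i = i) (in_face k x).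
Proof.
apply: (iffP forallP) => [h i ki|h i].
  by have := h i; rewrite ki => /andP[/eqP ? /eqP ?].
by apply/implyP => /h[-> ->]; rewrite !eqxx.
Qed.

Lemma in_face_lt k x (i : 'I_m) : in_face k x -> (x.2 i < k)%N = (i < k)%N.
Proof.
move=> /in_faceP xk; case: (ltnP i k) => [ik|ki].
  rewrite ltnNge; apply/negP => k2.
  have [_ /perm_inj e] := xk _ k2; by move: k2; rewrite e leqNgt ik.
by have [_ ->] := xk _ ki; apply/negbTE; rewrite -leqNgt.
Qed.

Definition flag_count (k : nat) : 'F_2 :=
  \sum_(x | in_face k x) \det (label_mx k (fun j => lab (vert x j))).

(** The face of dimension 0 is the origin, whose label must be 0. *)
Lemma flag_count0 : flag_count 0 = 1.
Proof.
pose x0 : flag := ([ffun _ => ord0], 1%g).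
rewrite /flag_count (big_pred1 x0) /=; last first.
  move=> x; apply/in_faceP/eqP => [h|-> i _]; last by rewrite !ffunE perm1.
  case: x h => z s /= h; congr pair.
    by apply/ffunP => i; apply: val_inj; rewrite !ffunE; case: (h i).
  by apply/permP => i; rewrite perm1; case: (h i).
rewrite det_mx11 mxE /=.
suff -> : lab (vert x0 0) = 0%N by [].
case: (posnP m) => [m0|m0].
  by apply/eqP; rewrite -leqn0 -[X in (_ <= X)%N]m0 lab_le.
apply/eqP; rewrite -leqn0; apply: (lab_bot (i := Ordinal m0)).
by rewrite !ffunE.
Qed.

Lemma in_face_lab k x j : in_face k x -> (k <= m)%N -> (j <= k)%N ->
  (lab (vert x j) <= k)%N.
Proof.
move=> xk km jk; case: (ltngtP k m) km => // [km _|-> _]; last exact: lab_le.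
apply: (lab_bot (i := Ordinal km)); rewrite ffunE.
move/in_faceP: xk => /(_ (Ordinal km) (leqnn _))[-> ->] /=.
by rewrite ltnNge jk.
Qed.

Section step.
Variables (k : nat) (km : (k < m)%N).
Let facet (x : flag) (j : nat) : 'F_2 :=
  \det (label_mx k (fun t => lab (vert x (bump j t)))).

(** A facet opposite to an inner vertex belongs to exactly two flags of the same
    cell, which differ by exchanging the steps j - 1 and j. The exchange changes
    the parity of the permutation, so pairing flags of opposite parities
    exhibits the sum as twice another one. *)
Lemma facet_inner (j : nat) : (0 < j <= k)%N ->
  \sum_(x | in_face k.+1 x) facet x j = 0.
Proof.
move=> /andP[j0 jk].
have j1m : (j.-1 < m)%N by lia.
have jm : (j < m)%N by lia.
pose t : 'S_m := tperm (Ordinal j1m) (Ordinal jm).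
pose T (x : flag) : flag := (x.1, x.2 * t)%g.
have tN : odd_perm t by rewrite odd_tperm -val_eqE /=; lia.
have TK : involutive T.
  by move=> [z s]; rewrite /T /= -mulgA tperm2 mulg1.
have facetT x : facet (T x) j = facet x j.
  rewrite /facet; congr (\det _); apply/matrixP => a b; rewrite !mxE.
  congr (_%:R); congr (nat_of_bool (_ == _)); congr lab.
  apply/ffunP => i; rewrite !ffunE; congr addn; congr nat_of_bool.
  rewrite /T /= permM /t /bump.
  by case: tpermP => [->|->|] //=; lia.
have inT x : in_face k.+1 (T x) = in_face k.+1 x.
  suff imp y : in_face k.+1 y -> in_face k.+1 (T y).
    by apply/idP/idP => [/imp|/imp//]; rewrite TK.
  move=> /in_faceP yk; apply/in_faceP => i ki.
  have [y1 y2] := yk i ki; split=> //=; rewrite permM y2.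
  by rewrite /t tpermD // -val_eqE /=; lia.
rewrite (bigID (fun x : flag => odd_perm x.2)) /= (reindex_inj (inv_inj TK)) /=.
rewrite [X in X + _](eq_bigl (fun x : flag => in_face k.+1 x && ~~ odd_perm x.2)); last first.
  by move=> x; rewrite inT odd_permM tN addbT.
by rewrite [X in X + _](eq_bigr (fun x => facet x j)) ?F2_addrr.
Qed.

(** Dropping the first vertex of a flag leaves the same simplex as dropping the
    last vertex of the flag that starts one vertex later and takes the first step
    last: [turn] passes from the former to the latter. The coordinate is
    increased cyclically, so that [turn] is a bijection of the whole type; it
    wraps around exactly at the facets on the upper side of the grid. *)
Definition cyc_fun (v : 'I_m) : 'I_m :=
  if (v == 0 :> nat)%N then Ordinal km else
  if (v <= k)%N then Ordinal (leq_ltn_trans (leq_pred v) (ltn_ord v)) else v.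

Lemma cyc_inj : injective cyc_fun.
Proof.
move=> u v /(congr1 val); rewrite /cyc_fun => e; apply: val_inj; move: e.
by repeat case: ifP => /=; lia.
Qed.

Definition cyc : 'S_m := perm cyc_inj.

Let m_gt0 : (0 < m)%N := leq_ltn_trans (leq0n k) km.
Definition first_dir (x : flag) : 'I_m := (x.2^-1)%g (Ordinal m_gt0).
Definition last_dir (x : flag) : 'I_m := (x.2^-1)%g (Ordinal km).

Definition turn (x : flag) : flag :=
  ([ffun i => if i == first_dir x then ordS (x.1 i) else x.1 i], (x.2 * cyc)%g).

Lemma turn_inj : injective turn.
Proof.
move=> [z s] [z' s'] [] /ffunP zz /mulIg ss; subst s'; congr pair.
apply/ffunP => i; have := zz i; rewrite !ffunE /first_dir /=.
by case: ifP => // _ /ordS_inj.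
Qed.

Lemma in_face_turn x : in_face k.+1 (turn x) = in_face k.+1 x.
Proof.
have cyc_id (i : 'I_m) : (k < i)%N -> cyc i = i.
  move=> ki; rewrite permE /cyc_fun; case: ifP => [|_]; first by lia.
  by rewrite leqNgt ki.
have dirE (i : 'I_m) : x.2 i = i -> (k < i)%N -> (i == first_dir x) = false.
  move=> e ki; apply/negP => /eqP ie; move: e; rewrite {1}ie permKV => /(congr1 val) /=.
  by lia.
apply/in_faceP/in_faceP => h i ki.
  have [/= z0 s0] := h i ki.
  have si : x.2 i = i by apply: (@perm_inj _ cyc); rewrite -permM s0 cyc_id.
  by move: z0; rewrite ffunE dirE.
have [z0 s0] := h i ki; rewrite /turn /= permM s0 cyc_id // ffunE dirE //.
Qed.

Let lower (x : flag) : 'F_2 := \det (label_mx k (fun t => lab (vert x t))).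
Definition top (x : flag) := x.1 (first_dir x) == N :> nat.
Definition bottom (x : flag) := x.1 (last_dir x) == 0%N :> nat.

Lemma last_dir_turn x : last_dir (turn x) = first_dir x.
Proof.
apply: (canLR (permK _)); rewrite /= permM /first_dir permKV permE /cyc_fun.
by apply: val_inj.
Qed.

Lemma bottom_turn x : bottom (turn x) = top x.
Proof.
rewrite /bottom last_dir_turn /top ffunE eqxx /=.
have := ltn_ord (x.1 (first_dir x)); set a := nat_of_ord _ => aN.
case: (a =P N) => [->|ne]; first by rewrite modnn eqxx.
by rewrite modn_small //; lia.
Qed.

Lemma facet_last x : facet x k.+1 = lower x.
Proof.
rewrite /facet /lower; congr (\det _); apply/matrixP => a b; rewrite !mxE.
by rewrite /bump leqNgt ltn_ord.
Qed.

Lemma facet_first x : ~~ top x -> facet x 0 = lower (turn x).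
Proof.
rewrite /top => ntop; rewrite /facet /lower; congr (\det _).
apply/matrixP => a b; rewrite !mxE.
congr (_%:R); congr (nat_of_bool (_ == _)); congr lab.
have bk := ltn_ord b.
apply/ffunP => i; rewrite !ffunE /= permM permE /cyc_fun /bump leq0n.
case: (i =P first_dir x) => [->|ne].
  have -> : x.2 (first_dir x) = Ordinal m_gt0 by rewrite permKV.
  move: ntop (ltn_ord (x.1 (first_dir x))) => /=.
  move: (nat_of_ord (x.1 (first_dir x))) => a0 a0N a0lt.
  by rewrite modn_small; lia.
case: ifP => [/eqP s0|s0].
  by case: ne; apply: (canRL (permK _)); apply: val_inj.
by move: s0; case: ifP => /=; lia.
Qed.

Lemma first_dir_le x : in_face k.+1 x -> (first_dir x <= k)%N.
Proof. by move=> xk; rewrite -ltnS -(in_face_lt _ xk) permKV. Qed.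

Lemma last_dir_le x : in_face k.+1 x -> (last_dir x <= k)%N.
Proof. by move=> xk; rewrite -ltnS -(in_face_lt _ xk) permKV /= ltnS. Qed.

Lemma facet_top x : in_face k.+1 x -> top x -> facet x 0 = 0.
Proof.
move=> xk /eqP xtop; apply/eqP/negPn/negP => ne0.
have [j jk /(lab_top _)] := det_label_mx_neq0 ne0 (first_dir_le xk).
by apply; rewrite ffunE permKV /= xtop addn1.
Qed.

(** As [x] is not in the smaller face, the direction i of its last step is less
    than k; so the facet lies on the side i = 0 of the grid, where the label k
    does not occur. *)
Lemma lower_bottom x : in_face k.+1 x -> bottom x -> ~~ in_face k x ->
  lower x = 0.
Proof.
move=> xk /eqP xbot nxk; apply/eqP/negPn/negP => ne0.
have lek : (last_dir x < k)%N.
  rewrite ltn_neqAle last_dir_le // andbT; apply: contra nxk => /eqP ek.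
  apply/in_faceP => i; rewrite leq_eqVlt => /orP[/eqP ki|]; last exact/in_faceP.
  have ei : i = last_dir x by apply: val_inj; rewrite /= ek.
  by rewrite {2}ei permKV ei; split => //; apply: val_inj; rewrite /= ek.
have [j jk lj] := det_label_mx_neq0 ne0 (leqnn k).
have := @lab_bot (vert x j) (last_dir x); rewrite lj leqNgt lek => h.
have : (k < j)%N = false by lia.
by move=> kj; apply/notF/h; rewrite ffunE permKV /= xbot kj.
Qed.

Lemma in_face_bottom x : in_face k x -> in_face k.+1 x && bottom x.
Proof.
move=> /in_faceP xk; have [z0 s0] := xk (Ordinal km) (leqnn k).
apply/andP; split; first by apply/in_faceP => i /ltnW /xk.
by apply/eqP; rewrite /last_dir -{1}s0 permK.
Qed.

(** The facets of the flags of a face cancel in pairs except those on the side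
    where the last coordinate vanishes, which are the flags of the next smaller
    face. *)
Lemma flag_count_step : flag_count k.+1 = flag_count k.
Proof.
have -> : flag_count k.+1 = \sum_(x | in_face k.+1 x) (facet x 0 + facet x k.+1).
  rewrite /flag_count (eq_bigr (fun x => \sum_(j < k.+2) facet x j)); last first.
    by move=> x xk; apply: det_label_mx_facets => j; exact: in_face_lab.
  rewrite exchange_big big_ord_recl big_ord_recr /= [X in _ + (X + _)]big1.
    by rewrite add0r big_split.
  by move=> j _; apply: facet_inner; rewrite /bump /=; case: j.
rewrite big_split /= (bigID top) /= big1 ?add0r; last first.
  by move=> x /andP[]; exact: facet_top.
rewrite (eq_bigr (fun x => lower (turn x))); last first.
  by move=> x /andP[_]; exact: facet_first.
rewrite (eq_bigl (fun x => in_face k.+1 (turn x) && ~~ bottom (turn x))); last first.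
  by move=> x; rewrite in_face_turn bottom_turn.
rewrite -(reindex_inj turn_inj (P := fun x => in_face k.+1 x && ~~ bottom x)) /=.
rewrite (eq_bigr lower (fun x _ => facet_last x)) [X in _ + X](bigID bottom) /=.
rewrite [X in _ + X]addrC addrA F2_addrr add0r (bigID (in_face k)) /=.
rewrite [X in _ + X]big1 ?addr0; last first.
  by move=> x /andP[/andP[? ?]]; exact: lower_bottom.
apply: eq_bigl => x; case: (boolP (in_face k x)) => [/in_face_bottom ->//|].
by rewrite andbF.
Qed.
End step.

Lemma sperner : exists x : flag,
  forall a, (a <= m)%N -> exists2 j : nat, (j <= m)%N & lab (vert x j) = a.
Proof.
have cm k : (k <= m)%N -> flag_count k = 1.
  by elim: k => [_|k ih km]; [exact: flag_count0 | rewrite flag_count_step // ih // ltnW].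
case: (pickP (fun x : flag => \det (label_mx m (fun j => lab (vert x j))) != 0)).
  by move=> x x0; exists x => // a am; exact: (det_label_mx_neq0 x0).
move=> no; have := cm m (leqnn m); rewrite /flag_count big1 => [/eqP|x _].
  by rewrite eq_sym oner_eq0.
by apply/eqP/negPn; rewrite no.
Qed.
End Sperner.

(** * Continuity on a subset of a normed module *)

Section cont_on.
Context {R : realType} {V W : normedModType R}.

(** Continuity for the subspace topology of [A], in epsilon-delta form: composing
    such maps needs no change of carrier types. *)
Definition cont_on (A : set V) (f : V -> W) : Prop :=
  forall x, A x -> forall e : R, 0 < e ->
    exists2 d : R, 0 < d & forall y, A y -> `|x - y| < d -> `|f x - f y| < e.

Lemma cont_onP (A : set V) (f : V -> W) :
  {within A, continuous f} <-> cont_on A f.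
Proof.
split=> [/subspace_continuousP fc x Ax e e0|fc].
  have /cvgrPdist_lt/(_ e e0) := fc x Ax.
  rewrite near_withinE => /nbhs_normP[d /= d0 dP]; exists d => // y Ay xy.
  exact: dP.
apply/subspace_continuousP => x Ax; apply/cvgrPdist_lt => e e0.
rewrite near_withinE; apply/nbhs_normP; have [d d0 dP] := fc x Ax e e0.
by exists d => //= y xy Ay; exact: dP.
Qed.

Lemma continuous_cont_on (A : set V) (f : V -> W) : continuous f -> cont_on A f.
Proof. by move=> /continuous_subspaceT fc; apply/cont_onP; exact: fc. Qed.

Lemma cont_on_sub (A B : set V) (f : V -> W) :
  A `<=` B -> cont_on B f -> cont_on A f.
Proof.
move=> AB fc x Ax e e0; have [d d0 dP] := fc x (AB _ Ax) e e0.
by exists d => // y /AB; exact: dP.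
Qed.

(** Heine-Cantor. *)
Lemma cont_on_unif (A : set V) (f : V -> W) : compact A -> cont_on A f ->
  forall e : R, 0 < e -> exists2 d : R, 0 < d &
    forall x y, A x -> A y -> `|x - y| < d -> `|f x - f y| < e.
Proof.
move=> /compact_near_coveringP cA fc e e0.
have e20 : 0 < e / 2 by rewrite divr_gt0.
have h x : A x -> \forall x' \near x & d \near 0^'+,
    forall y, A x' -> A y -> `|x' - y| < d -> `|f x' - f y| < e.
  move=> Ax; have [d d0 dP] := fc x Ax _ e20.
  have d20 : 0 < d / 2 by rewrite divr_gt0.
  near=> x' r => y Ax' Ay xy.
  have xx' : `|x - x'| < d / 2.
    by near: x'; apply/nbhs_normP; exists (d / 2).
  have rd : r < d / 2 by near: r; exact: nbhs_right_lt.
  have a1 : `|f x - f x'| < e / 2 by apply: dP => //; apply: lt_le_trans xx' _; lra.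
  have a2 : `|f x - f y| < e / 2.
    apply: dP => //.
    have -> : x - y = (x - x') + (x' - y) by rewrite addrA subrK.
    rewrite (splitr d); apply: le_lt_trans (ler_normD _ _) _.
    by apply: ltrD => //; apply: lt_trans rd.
  have -> : f x' - f y = (f x - f y) - (f x - f x') by rewrite opprB [RHS]addrC subrKA.
  by rewrite (splitr e); apply: le_lt_trans (ler_normB _ _) _; exact: ltrD.
have F := cA R _ _ (at_right_proper_filter 0) h.
have [d [d0 dP]] := filter_ex (filterI (nbhs_right_gt 0) F).
by exists d => // x y Ax; exact: dP.
Unshelve. all: by end_near. Qed.

End cont_on.

Lemma cont_on_norm (R : realType) (V W : normedModType R) (A : set V)
    (f : V -> W) :
  cont_on A f -> {within A, continuous (fun x => `|f x|)}.
Proof.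
move=> fc; apply/(@cont_onP R V R^o) => x Ax e e0.
have [d d0 dP] := fc x Ax e e0; exists d => // y Ay xy.
by apply: le_lt_trans (dP y Ay xy); exact: ler_dist_dist.
Qed.

Lemma cont_on_comp (R : realType) (U V W : normedModType R) (A : set U)
    (B : set V) (f : U -> V) (g : V -> W) :
  (forall x, A x -> B (f x)) -> cont_on A f -> cont_on B g ->
  cont_on A (fun x => g (f x)).
Proof.
move=> fAB fc gc x Ax e e0; have [d d0 dP] := gc _ (fAB _ Ax) e e0.
have [r r0 rP] := fc x Ax d d0; exists r => // y Ay xy.
by apply: dP (rP _ Ay xy); exact: fAB.
Qed.

(** * A zero of a map close to the identity *)

Section rV_norm.
Context {R : realType} {m : nat}.
Implicit Types (x : 'rV[R]_m) (r : R).

Lemma rV_coord_le x i : `|x ord0 i| <= `|x|.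
Proof.
rewrite [leRHS]/normr /= mx_normrE.
exact: (le_bigmax _ (fun ij => `|x ij.1 ij.2|) (ord0, i)).
Qed.

Lemma rV_norm_leP x r : 0 <= r -> (`|x| <= r) <-> (forall i, `|x ord0 i| <= r).
Proof.
move=> r0; split=> [xr i|h]; first exact: le_trans (rV_coord_le _ _) xr.
rewrite [leLHS]/normr /= mx_normrE; apply: bigmax_le => // -[i j] _ /=.
by rewrite ord1.
Qed.

Lemma rV_norm_ltP x r : 0 < r -> (`|x| < r) <-> (forall i, `|x ord0 i| < r).
Proof.
move=> r0; split=> [xr i|h]; first exact: le_lt_trans (rV_coord_le _ _) xr.
rewrite [ltLHS]/normr /= mx_normrE; apply: bigmax_lt => // -[i j] _ /=.
by rewrite ord1.
Qed.

Lemma compact_closed_ball (c : 'rV[R]_m) r : compact [set x | `|c - x| <= r].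
Proof.
apply: bounded_closed_compact; last exact: closed_closed_ball_.
exists (`|c| + r); split=> [|M Mr x /= xr]; first exact: num_real.
apply: ltW; apply: le_lt_trans Mr.
have -> : x = c - (c - x) by rewrite opprB addrC subrK.
by apply: le_trans (ler_normB _ _) _; rewrite lerD2l.
Qed.
End rV_norm.

(** This is the Poincare-Miranda theorem, the hypothesis giving the signs of the
    coordinates of [g] on the faces of the cube. Give a grid point the first
    index i at which the coordinate of [g] is at most 0. In a simplex that
    carries all labels every coordinate of [g] takes both signs, hence is small
    when the grid is fine; if [g] had no zero, its norm would be bounded below. *)
Lemma zero_of_close_to_id (R : realType) (m : nat) (g : 'rV[R]_m -> 'rV[R]_m) :
  cont_on [set x | `|x| <= 1] g ->
  (forall x, `|x| <= 1 -> `|g x - x| <= 1) ->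
  exists2 x, `|x| <= 1 & g x = 0.
Proof.
set Q := [set x | `|x| <= 1] => gc gid.
have cQ : compact Q.
  rewrite (_ : Q = [set x | `|0 - x| <= 1]); first exact: compact_closed_ball.
  by apply/seteqP; split => x; rewrite /Q /= sub0r normrN.
have [//|nz] := pselect (exists2 x, `|x| <= 1 & g x = 0).
exfalso.
have Q0 : Q !=set0 by exists 0; rewrite /Q /= normr0.
have ngc := cont_on_norm gc.
have [c /set_mem cQ' cmin] := compact_EVT_min Q0 cQ ngc.
have d0 : 0 < `|g c|.
  by rewrite normr_gt0; apply/eqP => gc0; apply: nz; exists c.
set d := `|g c| in cmin d0.
have [e e0 eP] := cont_on_unif cQ gc d0.
have [N Ne] : exists N : nat, 2 / N.+1%:R < e.
  exists (truncn (2 / e)); rewrite ltr_pdivrMr // mulrC -ltr_pdivrMr //.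
  exact: truncnS_gt.
pose pt (z : {ffun 'I_m -> nat}) : 'rV[R]_m :=
  \row_i (-1 + (2 / N.+1%:R) * (z i)%:R).
(* On the two faces orthogonal to i the answer is prescribed, so that labels obey
   the boundary conditions even where coordinate i of g vanishes. *)
pose bit (z : {ffun 'I_m -> nat}) (i : 'I_m) : bool :=
  (z i == 0%N) || (z i != N.+1) && (g (pt z) ord0 i <= 0).
pose lab (z : {ffun 'I_m -> nat}) := find (bit z) (enum 'I_m).
have lab_le z : (lab z <= m)%N.
  by rewrite -[X in (_ <= X)%N](size_enum_ord m) find_size.
have lab_lt z (i : 'I_m) : bit z i -> (lab z <= i)%N.
  move=> bi; rewrite leqNgt; apply/negP => /(before_find i).
  by rewrite nth_ord_enum bi.
have lab_at z (i : 'I_m) : lab z = i -> bit z i.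
  move=> li; have : has (bit z) (enum 'I_m).
    by rewrite has_find size_enum_ord -/(lab z) li.
  by move=> /(nth_find i); rewrite -/(lab z) li nth_ord_enum.
have lab_max z (i : 'I_m) : lab z = m -> ~~ bit z i.
  by move=> lm; apply/negP => /lab_lt; rewrite lm leqNgt ltn_ord.
have [||x xP] := @sperner m N lab lab_le.
- by move=> z i zi; apply: lab_lt; rewrite /bit zi.
- by move=> z i zi /lab_at; rewrite /bit zi eqxx.
have [j jm lj] := xP m (leqnn m).
pose v := vert x j.
have vertN k i : (vert x k i <= N.+1)%N.
  by rewrite ffunE; have := ltn_ord (x.1 i); case: (_ < k)%N; lia.
have N0 : 0 < N.+1%:R :> R by rewrite ltr0n.
have ptQ k : Q (pt (vert x k)).
  apply/rV_norm_leP => // i; rewrite mxE ler_norml.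
  have zN : (vert x k i)%:R <= N.+1%:R :> R by rewrite ler_nat.
  have z0 : 0 <= (vert x k i)%:R :> R by [].
  have : 2 / N.+1%:R * (vert x k i)%:R <= 2 :> R.
    by rewrite mulrAC ler_pdivrMr // ler_pM2l.
  have : 0 <= 2 / N.+1%:R * (vert x k i)%:R :> R.
    by rewrite !mulr_ge0 // invr_ge0 ltW.
  set a := _ * _ => a0 a2; apply/andP; split; lra.
have close k l : `|pt (vert x k) - pt (vert x l)| < e.
  apply/rV_norm_ltP => // i; rewrite !mxE !ffunE.
  apply: le_lt_trans Ne; rewrite !natrD.
  have : 0 <= 2 / N.+1%:R :> R by rewrite divr_ge0 // ltW.
  set a := _ / _; rewrite !mulrDr; set w := a * (x.1 i)%:R.
  by case: (_ < k)%N; case: (_ < l)%N => /= a0; rewrite ?mulr0 ?mulr1;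
    rewrite ler_norml; apply/andP; split; lra.
have small k : `|g (pt v) - g (pt (vert x k))| < d.
  by apply: eP; [exact: ptQ|exact: ptQ|exact: close].
have vQ := ptQ j; have gid_v := gid _ vQ.
have := cmin _ (mem_set vQ); rewrite leNgt => /negP; apply.
apply/rV_norm_ltP => // i.
have [k km lk] := xP i (ltnW (ltn_ord i)).
have pos : 0 <= g (pt v) ord0 i.
  have := lab_max _ i lj; rewrite /bit negb_or negb_and negbK => /andP[_].
  case: eqP => [vi _|_ /=]; last by rewrite -ltNge => /ltW.
  have := rV_coord_le (g (pt v) - pt v) i; rewrite !mxE vi.
  rewrite divfK ?gt_eqF // => h; have := le_trans h gid_v.
  by rewrite ler_norml => /andP[]; lra.
have neg : g (pt (vert x k)) ord0 i <= 0.
  have := lab_at _ _ lk; rewrite /bit => /orP[/eqP vi|/andP[]//].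
  have := rV_coord_le (g (pt (vert x k)) - pt (vert x k)) i; rewrite !mxE vi.
  rewrite mulr0 => h; have := le_trans h (gid _ (ptQ k)).
  by rewrite ler_norml => /andP[]; lra.
have := le_lt_trans (rV_coord_le (g (pt v) - g (pt (vert x k))) i) (small k).
rewrite !mxE ltr_norml => /andP[_]; rewrite ger0_norm // => h; lra.
Qed.

(** * Lipschitz approximation *)

Section lipschitz.
Context {R : realType}.

(** The largest L-Lipschitz function below [h] on [K], namely the infimum over y
    of h y + L |x - y|, is close to [h] once L is large: the points y close to x
    have h y close to h x, and for the others the penalty L |x - y| exceeds the
    oscillation of [h]. *)
Lemma lipschitz_approx_scalar (V : normedModType R) (K : set V) (h : V -> R^o)
    (e : R) : compact K -> cont_on K h -> 0 < e ->
  exists P : V -> R, exists2 L : R, 0 <= L /\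
    (forall x y, `|P x - P y| <= L * `|x - y|) &
    forall x, K x -> `|P x - h x| <= e.
Proof.
move=> cK hc e0.
have [K0|K0] := pselect (K !=set0); last first.
  exists (fun=> 0), 0; first by split=> // x y; rewrite subrr normr0 mul0r.
  by move=> x Kx; case: K0; exists x.
have [d d0 dP] := cont_on_unif cK hc e0.
have [M M0 hM] : exists2 M : R, 0 < M & forall x, K x -> `|h x| <= M.
  have [c Kc cmax] := compact_EVT_max K0 cK (cont_on_norm hc).
  exists (`|h c| + 1) => [|x /mem_set/cmax]; first by rewrite ltr_wpDl.
  by move=> hx; apply: le_trans hx _; rewrite lerDl.
pose L := 2 * M / d.
have L0 : 0 <= L by rewrite !mulr_ge0 // ?invr_ge0 ltW.
pose S x := [set h y + L * `|x - y| | y in K].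
have lbS x : lbound (S x) (- M).
  move=> _ [y Ky <-]; have := hM y Ky; rewrite ler_norml => /andP[hy _].
  by apply: le_trans hy _; rewrite lerDl mulr_ge0.
have S0 x : S x !=set0 by case: K0 => y Ky; exists (h y + L * `|x - y|), y.
have hasS x : has_inf (S x) by split; [exact: S0 | exists (- M); exact: lbS].
have infle x y : K y -> inf (S x) <= h y + L * `|x - y|.
  by move=> Ky; apply: inf_lbound; [case: (hasS x)|exists y].
have lip x y : inf (S x) - inf (S y) <= L * `|x - y|.
  rewrite lerBlDr -lerBlDl; apply: lb_le_inf => // _ [z Kz <-].
  rewrite lerBlDl; apply: le_trans (infle x z Kz) _.
  rewrite addrCA lerD2l -mulrDr ler_wpM2l //.
  have -> : x - z = (x - y) + (y - z) by rewrite subrKA.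
  exact: ler_normD.
exists (fun x => inf (S x)), L; first split=> // x y.
  by rewrite ler_norml lerNl opprB lip distrC lip.
move=> x Kx; rewrite ler_norml; apply/andP; split; last first.
  by have := infle x x Kx; rewrite subrr normr0 mulr0 addr0 => h1; lra.
rewrite lerBrDr; apply: lb_le_inf => // _ [y Ky <-].
have [xy|xy] := ltP `|x - y| d.
  have := dP x y Kx Ky xy; rewrite ltr_norml => /andP[_ h1].
  have : 0 <= L * `|x - y| by rewrite mulr_ge0.
  by move: h1; lra.
have := hM x Kx; have := hM y Ky; rewrite !ler_norml => /andP[h1 _] /andP[_ h2].
have : 2 * M <= L * `|x - y|.
  rewrite -[leLHS](divfK (lt0r_neq0 d0)).
  by rewrite ler_wpM2l.
by move: h1 h2; lra.
Qed.

Lemma lipschitz_approx (V : normedModType R) (n : nat) (K : set V)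
    (G : V -> 'rV[R]_n) (e : R) : compact K -> cont_on K G -> 0 < e ->
  exists P : V -> 'rV[R]_n, exists2 L : R, 0 <= L /\
    (forall x y, `|P x - P y| <= L * `|x - y|) &
    forall x, K x -> `|P x - G x| <= e.
Proof.
move=> cK Gc e0.
have hi (i : 'I_n) : exists PL : (V -> R) * R, (0 <= PL.2 /\
    (forall x y, `|PL.1 x - PL.1 y| <= PL.2 * `|x - y|)) /\
    forall x, K x -> `|PL.1 x - G x ord0 i| <= e.
  have [|P [L ? ?]] := @lipschitz_approx_scalar _ K (fun x => G x ord0 i) e cK _ e0.
    move=> x Kx r r0; have [d d0 dP] := Gc x Kx r r0; exists d => // y Ky xy.
    apply: le_lt_trans (dP y Ky xy).
    by have := rV_coord_le (G x - G y) i; rewrite !mxE.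
  by exists (P, L).
have [F FP] := choice hi.
exists (fun x => \row_i (F i).1 x), (\sum_i (F i).2).
  split=> [|x y]; first by apply: sumr_ge0 => i _; have [[]] := FP i.
  have sum_ge0 : 0 <= \sum_i (F i).2.
    by apply: sumr_ge0 => i _; have [[]] := FP i.
  apply/rV_norm_leP => [|i]; first by rewrite mulr_ge0.
  rewrite !mxE; have [[_ h] _] := FP i; apply: le_trans (h x y) _.
  rewrite ler_wpM2r // (bigD1 i) //= lerDl.
  by apply: sumr_ge0 => j _; have [[]] := FP j.
move=> x Kx; apply/rV_norm_leP => [|i]; first exact: ltW.
by rewrite !mxE; have [_] := FP i; exact.
Qed.

(** For the sup norm the sphere is the boundary of a cube, a union of 2 (m + 1)
    cubes of dimension m. Cut into N parts per side, they give of the order of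
    N ^ m pieces, whose images have diameter of order 1 / N. A grid of step
    slightly larger than this diameter has of the order of N ^ (m + 1) points v
    in the ball of radius [e]. An image of a piece contains at most one of them,
    so for large N some v is missed. *)
Lemma lipschitz_sphere_avoid (m : nat) (P : 'rV[R]_m.+1 -> 'rV[R]_m.+1)
    (L : R) (c : 'rV[R]_m.+1) (r e : R) :
  0 <= L -> (forall x y, `|P x - P y| <= L * `|x - y|) -> 0 < r -> 0 < e ->
  exists2 v, `|v| <= e & forall y, `|y - c| = r -> P y != v.
Proof.
move=> L0 Plip r0 e0.
(* C / N exceeds the diameter 4 r L / N of an image of a piece; N is a multiple
   M q of the number M of grid points per coordinate, so that the grid of step
   C / N fits into the ball as soon as C / q <= e. The choice of M makes
   M ^ (m + 1) larger than the number 2 (m + 1) (M q) ^ m of pieces. *)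
pose C := 4 * r * L + 1.
have C0 : 0 < C by rewrite ltr_wpDl // !mulr_ge0 // ltW.
pose q := (truncn (C / e)).+1.
have qC : C / e < q%:R by exact: truncnS_gt.
pose M := (m.+1 * 2 * q ^ m).+1.
pose N := (M * q)%N.
have N0 : (0 < N)%N by rewrite muln_gt0.
have NR0 : 0 < N%:R :> R by rewrite ltr0n.
pose s := C / N%:R.
have s0 : 0 < s by rewrite divr_gt0.
pose v (p : {ffun 'I_m.+1 -> 'I_M}) : 'rV[R]_m.+1 := \row_i (s * (p i)%:R).
have ve p : `|v p| <= e.
  apply/rV_norm_leP => [|i]; first exact: ltW.
  rewrite mxE ger0_norm; last by rewrite mulr_ge0 // ltW.
  have pM : (p i)%:R <= M%:R :> R by rewrite ler_nat ltnW.
  rewrite /s /N natrM mulrAC ler_pdivrMr -?natrM ?ltr0n //.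
  apply: le_trans (_ : C * M%:R <= _); first by rewrite ler_pM2l.
  rewrite natrM (mulrCA e) mulrC ler_wpM2l //.
  by apply: ltW; rewrite mulrC -ltr_pdivrMr.
have [//|nov] := pselect (exists2 v, `|v| <= e & forall y, `|y - c| = r -> P y != v).
exfalso.
have code p : exists yib : 'rV[R]_m.+1 * 'I_m.+1 * bool,
    let: (y, i, b) := yib in [/\ P y = v p, `|y - c| = r &
      y ord0 i - c ord0 i = (if b then r else - r)].
  have [//|noy] := pselect (exists2 y, `|y - c| = r & P y = v p); last first.
    case: nov; exists (v p) => // y yr; apply/eqP => Py.
    by case: noy; exists y.
  case=> y yr Py.
  have [i yi] : exists i, `|(y - c) ord0 i| = r.
    apply: contrapT => no; suff : `|y - c| < r by rewrite yr ltxx.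
    apply/rV_norm_ltP => // i; rewrite lt_neqAle -{2}yr rV_coord_le andbT.
    by apply/eqP => yi; apply: no; exists i.
  exists (y, i, 0 <= (y - c) ord0 i); split=> //.
  move: yi; rewrite !mxE; case: ger0P => [_ ->//|_ <-]; by rewrite opprK.
have [f fP] := choice code.
(* A side of the cube, of length 2 r, is cut into pieces of length 4 r / N, which
   keeps the index of its right end below N. *)
have cell_lt (y : 'rV[R]_m.+1) i : `|y - c| = r ->
    (truncn ((y ord0 i - c ord0 i + r) / (4 * r) * N%:R) < N)%N.
  move=> yr; have := rV_coord_le (y - c) i; rewrite yr !mxE ler_norml => /andP[h1 h2].
  have r40 : 0 < 4 * r by lra.
  rewrite truncn_lt_nat; last first.
    by rewrite !mulr_ge0 // ?invr_ge0; lra.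
  by rewrite gtr_pMl // ltr_pdivrMr //; lra.
pose cell (y : 'rV[R]_m.+1) (i : 'I_m.+1) : 'I_N :=
  Ordinal (ltn_pmod (truncn ((y ord0 i - c ord0 i + r) / (4 * r) * N%:R)) N0).
have cell_eq (y z : 'rV[R]_m.+1) i : `|y - c| = r -> `|z - c| = r ->
    cell y i = cell z i -> `|y ord0 i - z ord0 i| < 4 * r / N%:R.
  move=> yr zr /(congr1 val) /=; rewrite !modn_small ?cell_lt // => yz.
  have r40 : 0 < 4 * r by lra.
  have ge0 (x : 'rV[R]_m.+1) : `|x - c| = r ->
      0 <= (x ord0 i - c ord0 i + r) / (4 * r) * N%:R.
    move=> xr; have := rV_coord_le (x - c) i; rewrite xr !mxE ler_norml => /andP[h1 h2].
    by rewrite !mulr_ge0 // ?invr_ge0; lra.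
  have /andP[] := truncn_itv (ge0 y yr); have /andP[] := truncn_itv (ge0 z zr).
  rewrite yz; set t := truncn _; rewrite -[t.+1%:R]natr1.
  set Z := (z _ _ - _ + _) / _ * _; set Y := (y _ _ - _ + _) / _ * _ => z1 z2 y1 y2.
  have : `|Y - Z| < 1.
    by rewrite ltr_norml; apply/andP; split; lra.
  have -> : Y - Z = (y ord0 i - z ord0 i) / (4 * r) * N%:R.
    by rewrite /Y /Z -!mulrBl; congr (_ / _ * _); ring.
  rewrite normrM (gtr0_norm NR0) normrM normfV (gtr0_norm r40) => h.
  by move: h; rewrite mulrAC ltr_pdivrMr // mul1r ltr_pdivlMr.
pose key p : ('I_m.+1 * bool * {ffun 'I_m -> 'I_N}) :=
  let: (y, i, b) := f p in (i, b, [ffun k => cell y (lift i k)]).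
have key_inj : injective key.
  move=> p p'; rewrite /key; have := fP p; have := fP p'.
  case: (f p) => [[y i] b]; case: (f p') => [[y' i'] b'].
  move=> [Py' yr' yi'] [Py yr yi] [ii bb /ffunP cc]; subst i' b'.
  have yy : `|y - y'| <= 4 * r / N%:R.
    apply/rV_norm_leP => [|j]; first by rewrite !mulr_ge0 ?invr_ge0 // ltW.
    rewrite !mxE; have [k ->|->] := unliftP i j.
      by have := cc k; rewrite !ffunE => /(cell_eq _ _ _ yr yr')/ltW.
    have -> : y ord0 i - y' ord0 i = 0 by lra.
    by rewrite normr0 !mulr_ge0 ?invr_ge0 // ltW.
  have vv : `|v p - v p'| < s.
    rewrite -Py -Py'; apply: le_lt_trans (Plip _ _) _.
    apply: le_lt_trans (_ : L * (4 * r / N%:R) < _); first by rewrite ler_wpM2l.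
    by rewrite /s mulrA ltr_pM2r ?invr_gt0 // /C; lra.
  apply/ffunP => j; apply: val_inj => /=.
  have /rV_norm_ltP-/(_ s0 j) := vv; rewrite !mxE -mulrBr normrM gtr0_norm //.
  rewrite gtr_pMr //; move: (nat_of_ord (p j)) (nat_of_ord (p' j)) => a a'.
  rewrite ltr_norml => /andP[h1 h2].
  have : a%:R < 1 + a'%:R :> R by lra.
  have : a'%:R < 1 + a%:R :> R by lra.
  by rewrite !nat1r !ltr_nat !ltnS => h3 h4; apply/eqP; rewrite eqn_leq h4 h3.
have := leq_card key key_inj.
rewrite !card_prod !card_ffun !card_ord card_bool.
rewrite expnS /N expnMn mulnCA [leqRHS]mulnC leq_pmul2r.
  by rewrite /M ltnn.
by rewrite expn_gt0.
Qed.
End lipschitz.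

(** * Invariance of domain on the unit cube *)

Section domain.
Context {R : realType}.

(** Tietze's theorem, applied to each coordinate. *)
Lemma tietze_rV (V : normedModType R) (n : nat) (A : set V) (g : V -> 'rV[R]_n) :
  compact A -> cont_on A g ->
  exists G : V -> 'rV[R]_n, (forall x, A x -> G x = g x) /\ cont_on setT G.
Proof.
move=> cA gc.
have hi (i : 'I_n) : exists h : V -> R^o,
    (forall x, A x -> h x = g x ord0 i) /\ cont_on setT h.
  have gic : cont_on A (fun x => g x ord0 i : R^o).
    move=> x Kx r r0; have [d d0 dP] := gc x Kx r r0; exists d => // y Ky xy.
    apply: le_lt_trans (dP y Ky xy).
    by have := rV_coord_le (g x - g y) i; rewrite !mxE.
  have [A0|A0] := pselect (A !=set0); last first.
    exists (fun=> 0); split; first by move=> x Ax; case: A0; exists x.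
    by move=> x _ e e0; exists 1 => // y _ _; rewrite subrr normr0.
  have [c Ac cmax] := compact_EVT_max A0 cA (cont_on_norm gic).
  have M0 : 0 < `|g c ord0 i| + 1 by rewrite ltr_wpDl.
  have [||h [hA hc _]] := @continuous_bounded_extension V R
    (@pseudometric_normal R V) A _ (fun x => g x ord0 i) _ M0 ((cont_onP _ _).2 gic).
  - by apply: compact_closed => //; exact: norm_hausdorff.
  - by move=> x /mem_set/cmax h; apply: le_trans h _; rewrite lerDl.
  exists h; split; first by move=> x /mem_set/hA.
  exact: continuous_cont_on.
have [F FP] := choice hi.
exists (fun x => \row_i F i x); split.
  by move=> x Ax; apply/rowP => i; rewrite mxE; have [/(_ x Ax)] := FP i.
move=> x _ e e0.
have di i : exists d : R, 0 < d /\ forall y, `|x - y| < d -> `|F i x - F i y| < e.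
  have [_ /(_ x I e e0)[d d0 dP]] := FP i.
  by exists d; split=> // y; exact: dP.
have [d dP] := choice di.
exists (\big[Order.min/1]_i d i).
  by apply: lt_bigmin => // i _; case: (dP i).
move=> y _ xy; apply/rV_norm_ltP => // i; rewrite !mxE.
by have [_] := dP i; apply; apply: lt_le_trans xy _; exact: bigmin_le.
Qed.

Lemma compact_far (V : normedModType R) (Q : set V) (c : V) (e : R) :
  compact Q -> compact (Q `&` [set x | e <= `|c - x|]).
Proof.
move=> cQ; apply: compact_closedI => //.
have -> : [set x | e <= `|c - x|] = ~` ball c e.
  apply/seteqP; split => x /=; rewrite -ball_normE /ball_ /= => h.
    by rewrite leNgt in h; apply/negP.
  by rewrite leNgt; apply/negP.
apply: open_closedC; exact: ball_open.
Qed.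

Lemma compact_norm_ge (V W : normedModType R) (A : set V) (h : V -> W) :
  compact A -> cont_on A h -> (forall x, A x -> h x != 0) ->
  exists2 d : R, 0 < d & forall x, A x -> d <= `|h x|.
Proof.
move=> cA hc h0; have [A0|A0] := pselect (A !=set0); last first.
  by exists 1 => // x Ax; case: A0; exists x.
have [c /set_mem Ac cmin] := compact_EVT_min A0 cA (cont_on_norm hc).
exists `|h c|; first by rewrite normr_gt0 h0.
by move=> x /mem_set/cmin.
Qed.

(** The points of [Q] at distance at least e from x form a compact set on which
    [f] stays away from f x; its distance to f x is a modulus of continuity for
    the inverse. *)
Lemma cont_on_inverse (V W : normedModType R) (Q : set V) (f : V -> W) :
  compact Q -> cont_on Q f -> {in Q &, injective f} ->
  exists g : W -> V, (forall x, Q x -> g (f x) = x) /\ cont_on (f @` Q) g.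
Proof.
move=> cQ fc finj.
pose g y := xget 0 [set x | Q x /\ f x = y].
have gK x : Q x -> g (f x) = x.
  move=> Qx; rewrite /g; case: xgetP => [z _ [Qz fz]|/(_ x)[]//].
  by apply: finj; rewrite ?inE.
exists g; split=> // _ [x Qx <-] e e0; rewrite gK //.
have [||d d0 dP] := @compact_norm_ge _ _ (Q `&` [set z | e <= `|x - z|])
    (fun z => f x - f z) (compact_far cQ).
- move=> z [Qz _] r r0; have [d d0 dP] := fc z Qz r r0; exists d => // y [Qy _] zy.
  have -> : f x - f z - (f x - f y) = f y - f z by rewrite opprB addrC subrKA.
  by rewrite distrC; exact: dP.
- move=> z [Qz /= xz]; rewrite subr_eq0; apply/eqP => /finj xe; move: xz.
  by rewrite xe ?inE // subrr normr0 leNgt e0.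
exists d => // _ [z Qz <-] xz; rewrite gK // ltNge; apply/negP => ez.
by have := dP z (conj Qz ez); rewrite leNgt xz.
Qed.

(** The map that pushes the ball of radius [e] about [c] radially onto its sphere
    and fixes all points outside. *)
Lemma radial_continuous (V : normedModType R) (c : V) (e : R) (y : V) :
  y != c -> {for y, continuous (fun y => c + Num.max (e / `|y - c|) 1 *: (y - c))}.
Proof.
move=> yc.
apply: cvgD; first exact: cvg_cst.
have s : (fun z => z - c) @ y --> y - c by apply: cvgB; [exact: cvg_id|exact: cvg_cst].
apply: cvgZ => //.
have n : (fun z => e / `|z - c|) @ y --> e / `|y - c|.
  apply: cvgM; first exact: cvg_cst.
  apply: cvgV; first by rewrite normr_eq0 subr_eq0.
  exact: cvg_norm.
exact: (@continuous_max _ _ (fun z => e / `|z - c|) (cst 1) y n (@cst_continuous _ _ _ _)).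
Qed.

(** If f 0 is not interior to the image [A], some c outside [A] is close to f 0.
    The map [h] below replaces the identity G (f x) = x by P (Phi (f x)) - v:
    [Phi] pushes [A] out of a ball about c that contains f 0, [P] is Lipschitz
    and close to the extended inverse [G], and v is a small vector that [P] does
    not take on the sphere of the ball. Off the ball [h] vanishes nowhere since
    [G] is bounded below there, on the ball by the choice of v; yet [h] is close
    to the identity, because [G] is small on the ball. *)
Lemma domain_neighbourhood (m : nat) (f : 'rV[R]_m.+1 -> 'rV[R]_m.+1) :
  cont_on [set x | `|x| <= 1] f -> {in [set x | `|x| <= 1] &, injective f} ->
  exists2 r : R, 0 < r &
    forall y, `|f 0 - y| < r -> exists2 x, `|x| <= 1 & f x = y.
Proof.
set Q := [set x | `|x| <= 1] => fc finj.
have cQ : compact Q.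
  rewrite (_ : Q = [set x | `|0 - x| <= 1]); first exact: compact_closed_ball.
  by apply/seteqP; split => x; rewrite /Q /= sub0r normrN.
have Q0 : Q 0 by rewrite /Q /= normr0.
have [g [gK gc]] := cont_on_inverse cQ fc finj.
set A := f @` Q in gc.
have cA : compact A by apply: continuous_compact => //; apply/cont_onP.
have [G [GA Gc]] := tietze_rV cA gc.
have GK x : Q x -> G (f x) = x.
  by move=> Qx; rewrite GA ?gK //; exists x.
have [//|no] := pselect (exists2 r : R, 0 < r &
    forall y, `|f 0 - y| < r -> exists2 x, `|x| <= 1 & f x = y).
exfalso.
have p10 : 0 < 10^-1 :> R by rewrite invr_gt0.
have [d d0 dP] := Gc (f 0) I _ p10.
have {}dP y : `|f 0 - y| < d -> `|G y| < 10^-1.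
  by move=> /(dP y I); rewrite GK // sub0r normrN.
pose e := d / 2; have e0 : 0 < e by rewrite divr_gt0.
have [c cf cA'] : exists2 c, `|f 0 - c| < e & ~ A c.
  apply: contrapT => noc; apply: no; exists e => // y ye.
  by apply: contrapT => ny; apply: noc; exists y => // -[x Qx fx]; apply: ny; exists x.
(* The ball about c of radius e lies in the ball about f 0 of radius 2 e = d. *)
have near_c y : `|c - y| <= e -> `|G y| < 10^-1.
  move=> cy; apply: dP; have -> : f 0 - y = (f 0 - c) + (c - y) by rewrite subrKA.
  apply: le_lt_trans (ler_normD _ _) _.
  by rewrite [ltRHS]splitr -/e; exact: ltr_leD.
have [del del0 delP] : exists2 del : R, 0 < del &
    forall y, A y -> e <= `|c - y| -> del <= `|G y|.
  have [||del del0 delP] := @compact_norm_ge _ _ _ G (compact_far (c := c) (e := e) cA).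
  - exact: cont_on_sub Gc.
  - move=> _ [[x Qx <-] /= ex]; rewrite GK //; apply/eqP => x0.
    by move: ex; rewrite x0 distrC leNgt cf.
  - by exists del => // y Ay ey; apply: delP.
pose eta := Num.min (del / 3) 10^-1.
have eta0 : 0 < eta by rewrite lt_min p10 divr_gt0.
have eta1 : eta <= 10^-1 by rewrite ge_min lexx orbT.
have eta3 : eta <= del / 3 by rewrite ge_min lexx.
pose K := A `|` [set y | `|c - y| <= e].
have cK : compact K by apply: compactU => //; exact: compact_closed_ball.
have [P [L [L0 Plip] Papp]] := lipschitz_approx cK (cont_on_sub (@subsetT _ K) Gc) eta0.
have [v ve vP] := lipschitz_sphere_avoid c L0 Plip e0 eta0.
pose Phi y := c + Num.max (e / `|y - c|) 1 *: (y - c).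
have fxc x : Q x -> f x != c by move=> Qx; apply/eqP => fx; apply: cA'; exists x.
have Phi_far y : e <= `|c - y| -> Phi y = y.
  move=> ey; rewrite /Phi max_r; first by rewrite scale1r addrC subrK.
  by rewrite ler_pdivrMr ?mul1r distrC // (lt_le_trans e0).
have Phi_near y : y != c -> `|c - y| < e -> `|Phi y - c| = e.
  move=> yc ye; have yc0 : 0 < `|y - c| by rewrite normr_gt0 subr_eq0.
  rewrite /Phi max_l; last by rewrite ler_pdivlMr // mul1r distrC ltW.
  rewrite addrC addKr normrZ ger0_norm ?divr_ge0 ?ltW //.
  by rewrite divfK // gt_eqF.
pose h x := P (Phi (f x)) - v.
have hc : cont_on Q h.
  have PhiC : cont_on A Phi.
    move=> y [x Qx <-] r r0; have := radial_continuous (e := e) (fxc x Qx).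
    move=> /cvgrPdist_lt/(_ r r0) /nbhs_normP[b /= b0 bP].
    by exists b => // z _ /bP.
  apply: (@cont_on_comp _ _ _ _ Q A f (fun y => P (Phi y) - v)) => //.
    by move=> x Qx; exists x.
  apply: (@cont_on_comp _ _ _ _ A setT Phi (fun y => P y - v)) => //.
  move=> x _ r r0; exists (r / (L + 1)); first by rewrite divr_gt0 // ltr_wpDl.
  move=> y _ xy; rewrite opprB addrA subrK; apply: le_lt_trans (Plip x y) _.
  have L1 : 0 < L + 1 by rewrite ltr_wpDl.
  move: xy; rewrite ltr_pdivlMr // => xy; apply: le_lt_trans xy.
  by rewrite mulrC ler_wpM2l // lerDl.
have hid x : Q x -> `|h x - x| <= 1.
  move=> Qx.
  have [ex|ex] := leP e `|c - f x|.
    rewrite /h Phi_far //.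
    have := Papp (f x) (or_introl (ex_intro2 _ _ x Qx erefl)); rewrite GK // => h1.
    have -> : P (f x) - v - x = (P (f x) - x) - v by rewrite addrAC.
    apply: le_trans (ler_normB _ _) _.
    by move: h1 ve eta1; lra.
  have xG : `|x| < 10^-1 by rewrite -(GK x Qx); apply: near_c; exact: ltW.
  have PK : `|c - Phi (f x)| <= e by rewrite distrC Phi_near // fxc.
  have h1 := Papp _ (or_intror PK : K (Phi (f x))).
  have h2 := near_c _ PK.
  have -> : h x - x = (P (Phi (f x)) - G (Phi (f x))) + (G (Phi (f x)) - v) - x.
    by rewrite addrA subrK.
  apply: le_trans (ler_normB _ _) _.
  have := ler_normD (P (Phi (f x)) - G (Phi (f x))) (G (Phi (f x)) - v).
  have := ler_normB (G (Phi (f x))) v.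
  by move: h1 h2 xG ve eta1; lra.
have [x Qx hx] := zero_of_close_to_id hc hid.
have [ex|ex] := leP e `|c - f x|.
  move: hx; rewrite /h Phi_far // => /eqP; rewrite subr_eq0 => /eqP Pv.
  have Ax : A (f x) by exists x.
  have := Papp (f x) (or_introl Ax); rewrite Pv => h1.
  have := delP _ Ax ex; apply/negP; rewrite -ltNge.
  have -> : G (f x) = v - (v - G (f x)) by rewrite opprB addrC subrK.
  apply: le_lt_trans (ler_normB _ _) _.
  by move: h1 ve eta3; lra.
move: hx; rewrite /h => /eqP; rewrite subr_eq0; apply/negP.
apply: vP; apply: Phi_near => //; exact: fxc.
Qed.
End domain.

(** * Cells and their boundaries *)

Section cells.
Context {R : realType}.

Lemma invariance_of_domain (m : nat) (f : 'rV[R]_m.+1 -> 'rV[R]_m.+1)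
    (A : set 'rV[R]_m.+1) (a : 'rV[R]_m.+1) (r : R) :
  0 < r -> (forall x, `|a - x| <= r -> A x) ->
  cont_on A f -> {in A &, injective f} ->
  exists2 d : R, 0 < d & forall y, `|f a - y| < d -> exists2 x, A x & f x = y.
Proof.
move=> r0 rA fc finj.
have inA x : `|x| <= 1 -> A (a + r *: x).
  move=> x1; apply: rA; rewrite opprD addNKr normrN normrZ gtr0_norm //.
  by rewrite ger_pMr.
have [||d d0 dP] := @domain_neighbourhood R m (fun x => f (a + r *: x)).
- apply: cont_on_comp fc => //; move=> x _ e e0; exists (e / r).
    by rewrite divr_gt0.
  move=> y _ xy; rewrite opprD addrACA subrr add0r -scalerBr normrZ gtr0_norm //.
  by rewrite mulrC -ltr_pdivlMr.
- move=> x y /set_mem x1 /set_mem y1 /finj; rewrite !inE.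
  move=> /(_ (inA _ x1) (inA _ y1)) /addrI /(scalerI (lt0r_neq0 r0)).
  exact.
exists d => // y; rewrite -[a]addr0 -(scaler0 _ r) => /dP[x x1 <-].
by exists (a + r *: x) => //; exact: inA.
Qed.

Definition sqnorm (n : nat) (x : 'rV[R]_n) : R := \sum_(i < n) x ord0 i ^+ 2.

Lemma sqnormZ n (t : R) (x : 'rV[R]_n) : sqnorm (t *: x) = t ^+ 2 * sqnorm x.
Proof. by rewrite mulr_sumr; apply: eq_bigr => i _; rewrite mxE exprMn. Qed.

Lemma sqnorm_continuous n : continuous (@sqnorm n).
Proof.
rewrite /sqnorm; elim: (index_enum _) => [|i s ih] x.
  rewrite (_ : (fun _ => _) = cst 0); first exact: cst_continuous.
  by apply/funext => y; rewrite big_nil.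
rewrite (_ : (fun _ => _) = (fun y : 'rV[R]_n =>
    y ord0 i ^+ 2 + \sum_(j <- s) y ord0 j ^+ 2)); last first.
  by apply/funext => y; rewrite big_cons.
have h : {for x, continuous (fun y : 'rV[R]_n => (y ord0 i ^+ 2 : R^o))}.
  apply: (@continuous_comp _ _ _ (fun x : 'rV[R]_n => x ord0 i) (fun t => t ^+ 2)).
    exact: coord_continuous.
  exact: exprn_continuous.
exact: (cvgD h (ih x)).
Qed.

Lemma eball_interior n (b : 'rV[R]_n) : sqnorm b < 1 ->
  exists2 r : R, 0 < r & forall x, `|b - x| <= r -> eball x.
Proof.
move=> b1; have e0 : 0 < 1 - sqnorm b by rewrite subr_gt0.
have /cvgrPdist_lt/(_ _ e0)/nbhs_normP[r /= r0 rP] := @sqnorm_continuous n b.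
exists (r / 2); first by rewrite divr_gt0.
move=> x bx; have /rP : ball_ normr b r x.
  by rewrite /ball_ /=; apply: le_lt_trans bx _; lra.
rewrite ltr_norml /eball /= -/(sqnorm x) => /andP[h _]; lra.
Qed.

Lemma homeomorphism_inverse (V W : normedModType R) (A : set V) (B : set W)
    (f : V -> W) : homeomorphism A B f ->
  exists g : W -> V, [/\ (forall x, A x -> B (f x)) /\ (forall y, B y -> A (g y)),
    (forall x, A x -> g (f x) = x), (forall y, B y -> f (g y) = y),
    cont_on A f & cont_on B g].
Proof.
move=> [[fAB finj fsurj] fc [g [gc fK]]].
have gK x : A x -> g (f x) = x by move=> /mem_set/fK.
exists g; split; rewrite -?cont_onP //.
- split=> [x /fAB//|y /fsurj[x Ax <-]]; by rewrite gK.
- by move=> y /fsurj[x Ax <-]; rewrite gK.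
Qed.

Lemma cont_onZ (V W : normedModType R) (A : set V) (s : V -> R^o) (f : V -> W) :
  cont_on A s -> cont_on A f -> cont_on A (fun x => s x *: f x).
Proof.
move=> /cont_onP sc /cont_onP fc; apply/cont_onP => x.
by apply: cvgZ; [exact: sc|exact: fc].
Qed.

(** The boundary of a cell does not depend on the parametrization: if the point
    of the sphere that one parametrization assigns to y corresponded to an
    interior point under another one, the transition map would carry a
    neighbourhood of this interior point to a neighbourhood of a point of the
    sphere, but its values stay in the ball. *)
Lemma cell_boundary_sphere (q n : nat) (D : set 'rV[R]_q) (f : 'rV[R]_n -> 'rV[R]_q) :
  homeomorphism (@eball R n) D f -> cell_boundary n D `<=` f @` @esphere R n.
Proof.
move=> /homeomorphism_inverse[g [[fD gB] gK fK fc gc]] y [f1 [hf1 [z zS zy]]].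
have [g1 [[f1D g1B] g1K f1K f1c g1c]] := homeomorphism_inverse hf1.
have zB : eball z by rewrite /eball /=; move: zS; rewrite /esphere /= => ->.
have Dy : D y by rewrite -zy; exact: f1D.
have Bb := gB _ Dy; exists (g y); last exact: fK.
have [//|nS] := pselect (esphere (g y)); exfalso.
have b1 : sqnorm (g y) < 1.
  by rewrite lt_neqAle; apply/andP; split=> //; apply/eqP.
have [m nE] : exists m, n = m.+1.
  case: n {Bb nS b1 f hf1 fD gB gK fK fc gc f1 g1 f1D g1B g1K f1K f1c g1c zy zB g} z zS.
    by move=> z; rewrite /esphere /= big_ord0 => /eqP; rewrite eq_sym oner_eq0.
  by move=> m _ _; exists m.
subst n.
have [r r0 rP] := eball_interior b1.
have [||d d0 dP] := @invariance_of_domain m (fun x => g1 (f x)) _ _ r r0 rP.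
- exact: cont_on_comp fc g1c.
- move=> u v /set_mem Bu /set_mem Bv e.
  by rewrite -(gK u Bu) -(gK v Bv) -(f1K (f u) (fD _ Bu)) e f1K //; exact: fD.
have nz : 0 < 2 * (`|z| + 1) by rewrite mulr_gt0 // ltr_wpDl.
pose t := d / (2 * (`|z| + 1)).
have t0 : 0 < t by rewrite divr_gt0.
have [|x Bx xw] := dP ((1 + t) *: z).
  rewrite fK // -zy g1K // scalerDl scale1r opprD addNKr normrN normrZ gtr0_norm //.
  rewrite /t mulrAC ltr_pdivrMr // ltr_pM2l //.
  have := normr_ge0 z; lra.
have := g1B _ (fD _ Bx); rewrite xw /eball /= -/(sqnorm _) sqnormZ.
by move: zS; rewrite /esphere /= -/(sqnorm z) => ->; rewrite mulr1; nra.
Qed.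

Section cons.
Context {n : nat}.
Definition cons_rV (t : R) (z : 'rV[R]_n) : 'rV[R]_n.+1 :=
  \row_i oapp (z ord0) t (unlift ord0 i).
Definition tail_rV (w : 'rV[R]_n.+1) : 'rV[R]_n := \row_i w ord0 (lift ord0 i).

Lemma cons_rV0 t (z : 'rV[R]_n) : cons_rV t z ord0 ord0 = t.
Proof. by rewrite mxE unlift_none. Qed.

Lemma tail_consK t (z : 'rV[R]_n) : tail_rV (cons_rV t z) = z.
Proof. by apply/rowP => i; rewrite !mxE liftK. Qed.

Lemma cons_tailK (w : 'rV[R]_n.+1) : cons_rV (w ord0 ord0) (tail_rV w) = w.
Proof.
by apply/rowP => i; rewrite !mxE; case: unliftP => [j ->|->] //=; rewrite mxE.
Qed.

Lemma tail_rV_dist (x y : 'rV[R]_n.+1) : `|tail_rV x - tail_rV y| <= `|x - y|.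
Proof.
apply/rV_norm_leP => // i; rewrite !mxE.
by have := rV_coord_le (x - y) (lift ord0 i); rewrite !mxE.
Qed.

Lemma cons_rV_dist t (x y : 'rV[R]_n) : `|cons_rV t x - cons_rV t y| <= `|x - y|.
Proof.
apply/rV_norm_leP => // i; rewrite !mxE; case: unliftP => [j _|_] /=.
  by have := rV_coord_le (x - y) j; rewrite !mxE.
by rewrite subrr normr0.
Qed.
End cons.

(** If x is interior to [C], the cone over [C] is a neighbourhood of x by
    invariance of domain, so [C] contains the points of [C'] near x. Then a cube
    in [C'] embeds in the cell of lower dimension [C `&` C'], hence in a
    hyperplane, again contrary to invariance of domain. *)
Lemma cell_meet_boundary (q m : nat) (D C C' : set 'rV[R]_q) :
  is_cell m.+2 D -> is_cell m.+1 C -> is_cell m.+1 C' -> is_cell m (C `&` C') ->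
  C `<=` cell_boundary m.+2 D -> C' `<=` cell_boundary m.+2 D ->
  C `&` C' `<=` cell_boundary m.+1 C.
Proof.
move=> [f hf] [phi hphi] [psi hpsi] [chi hchi] CD C'D x [Cx C'x].
have [g [[fD gB] gK fK fc gc]] := homeomorphism_inverse hf.
have [phi' [[phiC phi'B] phiK phi'K phic phi'c]] := homeomorphism_inverse hphi.
have [psi' [[psiC psi'B] psiK psi'K psic psi'c]] := homeomorphism_inverse hpsi.
have [chi' [[chiC chi'B] chiK chi'K chic chi'c]] := homeomorphism_inverse hchi.
have Dsub S : S `<=` cell_boundary m.+2 D -> S `<=` D.
  move=> SD y /SD/(cell_boundary_sphere hf)[z zS <-]; apply: fD.
  by move: zS; rewrite /esphere /eball /= => ->.
have gS S : S `<=` cell_boundary m.+2 D -> forall y, S y -> sqnorm (g y) = 1.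
  move=> SD y /SD/(cell_boundary_sphere hf)[z zS <-]; rewrite gK //.
  by move: zS; rewrite /esphere /eball /= => ->.
have [S1|nS] := pselect (esphere (phi' x)).
  by exists phi; split=> //; exists (phi' x); rewrite ?phi'K.
exfalso.
have a1 : sqnorm (phi' x) < 1.
  by rewrite lt_neqAle; apply/andP; split; [exact/eqP|exact: phi'B].
have [r r0 rP] := eball_interior a1.
(* In coordinates of D, the points of C and C' have norm 1. The thickening of C
   is parametrized by the scale, as first coordinate, and the parameter of C;
   the norm of a point of the cone gives back its scale, whence injectivity. *)
have [d d0 dP] : exists2 d : R, 0 < d & forall y, C' y -> `|g x - g y| < d -> C y.
  pose w0 : 'rV[R]_m.+2 := cons_rV 1 (phi' x).
  pose s := Num.min r 2^-1.
  have s0 : 0 < s by rewrite lt_min r0 invr_gt0 ltr0n.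
  pose B := [set w : 'rV[R]_m.+2 | `|w0 - w| <= s].
  pose H (w : 'rV[R]_m.+2) := w ord0 ord0 *: g (phi (tail_rV w)).
  have Btail w : B w -> eball (tail_rV w).
    move=> Bw; apply: rP; rewrite -(tail_consK 1 (phi' x)).
    apply: le_trans (tail_rV_dist _ _) _; apply: le_trans Bw _.
    by rewrite ge_min lexx.
  have Bt w : B w -> 0 < w ord0 ord0.
    move=> Bw; have := le_trans (rV_coord_le _ ord0) Bw.
    rewrite !mxE unlift_none /= => h.
    have : `|1 - w ord0 ord0| <= 2^-1 by apply: le_trans h _; rewrite ge_min lexx orbT.
    by rewrite ler_norml => /andP[_]; lra.
  have Hsq w : B w -> sqnorm (H w) = w ord0 ord0 ^+ 2.
    by move=> Bw; rewrite sqnormZ (gS C) ?mulr1 //; exact/phiC/Btail.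
  have Hc : cont_on B H.
    apply: cont_onZ.
      move=> w _ e e0; exists e => // v _ wv; apply: le_lt_trans wv.
      by have := rV_coord_le (w - v) ord0; rewrite !mxE.
    apply: (@cont_on_comp _ _ _ _ B D (fun w => phi (tail_rV w)) g) => //.
      by move=> w Bw; apply: (Dsub C) => //; exact/phiC/Btail.
    apply: cont_on_comp phic => //.
    move=> w _ e e0; exists e => // v _ wv; apply: le_lt_trans wv.
    exact: tail_rV_dist.
  have Hinj : {in B &, injective H}.
    move=> u v /set_mem Bu /set_mem Bv e.
    have t_eq : u ord0 ord0 = v ord0 ord0.
      apply/eqP; rewrite -(eqrXn2 (n := 2)) ?ltW ?Bt //.
      by rewrite -!Hsq // e.
    move: e; rewrite /H t_eq => /(scalerI (lt0r_neq0 (Bt _ Bv))) e.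
    rewrite -(cons_tailK u) -(cons_tailK v) t_eq; congr cons_rV.
    rewrite -(phiK _ (Btail _ Bu)) -(phiK _ (Btail _ Bv)); congr phi'.
    have Du := Dsub C CD _ (phiC _ (Btail _ Bu)).
    have Dv := Dsub C CD _ (phiC _ (Btail _ Bv)).
    by rewrite -(fK _ Du) -(fK _ Dv) e.
  have [d d0 dP] := invariance_of_domain s0 (A := B) (a := w0) (fun _ h => h) Hc Hinj.
  exists d => // y C'y gxy.
  have Hw0 : H w0 = g x by rewrite /H cons_rV0 scale1r tail_consK phi'K.
  have [|w Bw Hw] := dP (g y); first by rewrite Hw0.
  have w1 : w ord0 ord0 = 1.
    apply/eqP; rewrite -(eqrXn2 (n := 2)) ?ltW ?Bt //.
    by rewrite -Hsq // Hw expr1n (gS C').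
  have gy : g (phi (tail_rV w)) = g y by rewrite -Hw /H w1 scale1r.
  have <- : phi (tail_rV w) = y.
    have Dw := Dsub C CD _ (phiC _ (Btail _ Bw)).
    by rewrite -(fK _ Dw) gy fK //; apply: (Dsub C').
  exact/phiC/Btail.
pose b := psi' x.
have Bb : eball b by exact: psi'B.
have gpsic : cont_on (@eball R m.+1) (fun u => g (psi u)).
  by apply: cont_on_comp psic gc => u /psiC; exact: (Dsub C').
have [e e0 eP] := gpsic b Bb d d0.
have E_near u : eball u -> `|b - u| < e -> (C `&` C') (psi u).
  move=> Bu bu; split; last exact: psiC.
  apply: dP; first exact: psiC.
  by have := eP u Bu bu; rewrite psi'K.
(* As b may lie on the sphere, it is moved towards 0 to leave room for a cube. *)
have [b' [s s0 sP]] : exists b' : 'rV[R]_m.+1, exists2 s : R, 0 < s &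
    forall u, `|b' - u| <= s -> eball u /\ `|b - u| < e.
  have n0 : 0 < 2 * (`|b| + 1) by rewrite mulr_gt0 // ltr_wpDl.
  pose t := Num.min (e / (2 * (`|b| + 1))) 2^-1.
  have t0 : 0 < t by rewrite lt_min divr_gt0 // invr_gt0 ltr0n.
  have t2 : t <= 2^-1 by rewrite ge_min lexx orbT.
  have b'1 : sqnorm ((1 - t) *: b) < 1.
    have := Bb; rewrite /eball /= -/(sqnorm b) sqnormZ => b1.
    apply: le_lt_trans (_ : (1 - t) ^+ 2 * 1 < _); last by nra.
    by rewrite ler_wpM2l // sqr_ge0.
  have [s s0 sP] := eball_interior b'1.
  exists ((1 - t) *: b), (Num.min s (e / 4)); first by rewrite lt_min s0 divr_gt0.
  move=> u us; split; first by apply: sP; apply: le_trans us _; rewrite ge_min lexx.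
  have -> : b - u = t *: b + ((1 - t) *: b - u).
    by rewrite addrA -scalerDl addrCA subrr addr0 scale1r.
  apply: le_lt_trans (ler_normD _ _) _; rewrite normrZ gtr0_norm //.
  have : t * `|b| <= e / 2.
    apply: le_trans (_ : e / (2 * (`|b| + 1)) * `|b| <= _).
      by rewrite ler_wpM2r // ge_min lexx.
    rewrite mulrAC ler_pdivrMr // [leRHS]mulrA divfK ?pnatr_eq0 //.
    by rewrite ler_pM2l // lerDl.
  have : `|(1 - t) *: b - u| <= e / 4.
    by apply: le_trans us _; rewrite ge_min lexx orbT.
  by lra.
pose A := [set u : 'rV[R]_m.+1 | eball u /\ `|b - u| < e].
(* The first coordinate is constantly 0, so the image has no interior. *)
pose k (u : 'rV[R]_m.+1) : 'rV[R]_m.+1 := cons_rV 0 (chi' (psi u)).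
have AE u : A u -> (C `&` C') (psi u) by case; exact: E_near.
have [||c c0 cP] := @invariance_of_domain m k A b' s s0 sP.
- apply: (@cont_on_comp _ _ _ _ A setT (fun u => chi' (psi u)) (cons_rV 0)) => //.
    apply: cont_on_comp chi'c => //.
    by apply: cont_on_sub psic => u [].
  move=> u _ r' r'0; exists r' => // v _; apply: le_lt_trans; exact: cons_rV_dist.
- move=> u v /set_mem Au /set_mem Av uv.
  rewrite -(psiK _ Au.1) -(psiK _ Av.1); congr psi'.
  rewrite -(chi'K _ (AE _ Au)) -(chi'K _ (AE _ Av)); congr chi.
  by rewrite -[LHS](tail_consK 0) -[RHS](tail_consK 0); congr tail_rV.
have [|u Au ku] := cP (cons_rV (c / 2) (chi' (psi b'))).
  apply/rV_norm_ltP => // i; rewrite !mxE; case: unliftP => [j _|_] /=.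
    by rewrite subrr normr0.
  by rewrite sub0r normrN gtr0_norm ?divr_gt0 //; lra.
have := congr1 (fun w : 'rV[R]_m.+1 => w ord0 ord0) ku.
by rewrite !cons_rV0; lra.
Qed.
End cells.

(** * The traces of a collection on one of its members *)

Lemma cell_boundary_sub (R : realType) (q m : nat) (D : set 'rV[R]_q) :
  cell_boundary m D `<=` D.
Proof.
move=> y [f [[[fD _ _] _ _] [x xS <-]]]; apply: fD.
by move: xS; rewrite /esphere /eball /= => ->.
Qed.

(** The traces of the members [e j] on a member [o] that they all meet. *)
Section link.
Variables (R : realType) (q n : nat) (I K : finType).
Variables (D : I -> set 'rV[R]_q) (o : I) (e : K -> I).
Hypotheses (n1 : (1 <= n)%N) (hW : LCL n D).
Hypotheses (e_inj : injective e) (eo : forall j, e j != o).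
Hypothesis (De : forall j, D o `&` D (e j) !=set0).

Let V j := D (e j).
Let U j := D o `&` V j.
Let star (J : {set K}) : {set I} := o |: e @: J.

Implicit Types J : {set K}.

Lemma card_star J : #|star J| = #|J|.+1.
Proof.
rewrite cardsU1 card_imset // (_ : o \notin _) //.
by apply/imsetP => -[j _ oj]; have := eo j; rewrite -oj eqxx.
Qed.

(** This identity carries the properties of the collection over to the traces. *)
Lemma meet_star J : (0 < #|J|)%N -> meet D (star J) = meet U J.
Proof.
move=> /card_gt0P[j0 j0J]; apply/seteqP; split=> x xm.
  move=> j jJ; split; first by apply: xm; rewrite /= !inE eqxx.
  by apply: xm; rewrite /= !inE imset_f ?orbT.
move=> i /=; rewrite !inE => /orP[/eqP->|/imsetP[j jJ ->]].
  by have [] := xm _ j0J.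
by have [] := xm _ jJ.
Qed.

Lemma star_centered J : (0 < #|J|)%N ->
  (forall i k, i \in J -> k \in J -> V i `&` V k !=set0) -> meet U J !=set0.
Proof.
move=> J0 VJ; rewrite -meet_star //; have [_ lc _] := hW; apply: lc => i k.
have [j0 _] := card_gt0P J0.
rewrite !inE => /orP[/eqP->|/imsetP[j jJ ->]] /orP[/eqP->|/imsetP[l lJ ->]] //.
- by have [x [Dx _]] := De j0; exists x.
- by rewrite setIC.
- exact: VJ.
Qed.

Lemma meet_U1 j : meet U [set j]%SET = U j.
Proof.
by apply/seteqP; split=> x => [|Ux k]; [apply; rewrite /= inE|rewrite /= inE => /eqP->].
Qed.

Lemma meet_U2 j k : meet U [set j; k]%SET = U j `&` U k.
Proof.
apply/seteqP; split=> x => [xm|[Uj Uk] i].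
  by split; apply: xm; rewrite /= !inE eqxx ?orbT.
by rewrite /= !inE => /orP[] /eqP->.
Qed.

Lemma lump_star J : (0 < #|J|)%N -> meet U J !=set0 ->
  [/\ meet U J `<=` cell_boundary n (D o), (#|J| <= n)%N &
      is_cell (n - #|J|) (meet U J)].
Proof.
move=> J0 UJ; have [_ _ ll] := hW.
have [||bd card cell] := ll (star J); rewrite ?card_star ?meet_star //.
rewrite card_star meet_star // subSS in bd card cell; split=> //.
by rewrite bd => x; apply; rewrite /= !inE eqxx.
Qed.

Lemma U_cell j : is_cell n.-1 (U j).
Proof.
have [||_ _] := @lump_star [set j]%SET; rewrite ?cards1 ?meet_U1 //; first exact: De.
by rewrite subn1.
Qed.

Lemma U_boundary j : U j `<=` cell_boundary n (D o).
Proof.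
have [||+ _ _] := @lump_star [set j]%SET; rewrite ?cards1 ?meet_U1 //; exact: De.
Qed.

(** That a meet of traces consists of boundary points follows from the case of
    two traces: each member of [J] is paired with any other one. *)
Lemma link_LCL : LCL n.-1 U.
Proof.
split; first exact: U_cell.
  move=> J UJ; have [J0|J0] := posnP #|J|.
    by exists 0 => i /=; rewrite (cards0_eq J0) inE.
  apply: star_centered => // i k iJ kJ.
  by have [x [[_ Vi] [_ Vk]]] := UJ i k iJ kJ; exists x.
move=> J J2 UJ; have J0 : (0 < #|J|)%N by exact: leq_trans J2.
have [_ card cell] := lump_star J0 UJ; rewrite prednK //; split=> //.
apply/seteqP; split=> x xm j jJ; last exact: cell_boundary_sub (xm _ jJ).
have [k] : exists2 k, k \in J & k != j.
  have : (0 < #|J :\ j|)%N by move: J2; rewrite (cardsD1 j) jJ.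
  by move=> /card_gt0P[k]; rewrite !inE => /andP[? ?]; exists k.
move=> kJ kj; have xjk : (U j `&` U k) x by split; exact: xm.
have card2 : #|[set j; k]%SET| = 2 by rewrite cards2 eq_sym kj.
have [||_ n2] := @lump_star [set j; k]%SET; rewrite ?meet_U2 ?card2 //.
  by exists x.
move=> cell2; have nE : n = n.-2.+2 by lia.
have Uj := U_cell j; have Uk := U_cell k.
have Bj := @U_boundary j; have Bk := @U_boundary k.
have [Dc _ _] := hW; have Do := Dc o.
rewrite nE /= in Uj Uk Bj Bk Do *.
apply: (cell_meet_boundary Do Uj Uk _ Bj Bk) => //.
by rewrite nE !subSS subn0 in cell2.
Qed.

Lemma link_isomorphic : isomorphic_collections V U.
Proof.
move=> J J0; split=> [[x xV]|[x xU]].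
  by apply: star_centered => // i k iJ kJ; exists x; split; exact: xV.
by exists x => j /xU[].
Qed.
End link.

Theorem theorem2p1 (R : realType) (q n s p : nat)
    (hn : (1 <= n)%N) (hnq : (n <= q)%N) (hps : (p <= s)%N)
    (D : 'I_s.+1 -> set 'rV[R]_q)
    (hW : LCL n D)
    (hV : forall i : 'I_s.+1,
        i != ord0 -> ((D ord0 `&` D i !=set0) <-> (i <= p)%N)) :
  let V : 'I_p -> set 'rV[R]_q :=
    fun j => D (widen_ord (hps : (p.+1 <= s.+1)%N) (lift ord0 j)) in
  let U : 'I_p -> set 'rV[R]_q := fun j => D ord0 `&` V j in
  LCL n.-1 U /\ isomorphic_collections V U.
Proof.
move=> V U.
pose e (j : 'I_p) : 'I_s.+1 := widen_ord (hps : (p.+1 <= s.+1)%N) (lift ord0 j).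
have e_inj : injective e.
  by move=> i j /(congr1 val) /=; rewrite /bump !leq0n !add1n => -[]; exact: val_inj.
have eo j : e j != ord0 by [].
have De j : D ord0 `&` D (e j) !=set0.
  by apply/hV => //=; rewrite /bump /= add1n.
split; first exact: (link_LCL hn hW e_inj eo De).
exact: (link_isomorphic hW De).
Qed.
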